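(* Let $\mathcal{P}=\{P_0,\dots,P_{g-1}\}$ be a set of $g$ $n\times n$ PDAs that are Blackburn-compatible w.r.t. an $n\times n$ PDA $P_\ast$ with $\mathcal{S}$ as its set of integers. Let $\mathcal{S}_j$, $j\in[g(g-1)]\cup\{t\}$ ($t$ being an additional index), be pairwise disjoint sets of integers, disjoint from the integers of $P_0,\dots,P_{g-1}$, with $|\mathcal{S}_j|=|\mathcal{S}|$, and let $P_\ast(\mathcal{S}_j)$ denote the PDA obtained by replacing the integers of $P_\ast$ by those in $\mathcal{S}_j$ (bijectively). Let $\pi(l)=(l+1)\bmod g$ be the cyclic shift permutation on $[g]$. For $i\in[g]$ let $P'_i$ be the $ng\times ng$ array consisting of $g\times g$ blocks of size $n\times n$ whose diagonal blocks are, in order, $P_{\pi^i(1)},P_{\pi^i(2)},\dots,P_{\pi^i(g)}$ (indices read modulo $g$), and whose $g(g-1)$ off-diagonal blocks, read row by row, are $P_\ast(\mathcal{S}_0),P_\ast(\mathcal{S}_1),\dots,P_\ast(\mathcal{S}_{g(g-1)-1})$ (the same for every $i$). Let $P'_\ast$ be the $ng\times ng$ block diagonal array with all $g$ diagonal blocks equal to $P_\ast(\mathcal{S}_t)$ and all off-diagonal blocks equal to the $n\times n$ all-$\ast$ array. Then $\mathcal{P}'=\{P'_0,\dots,P'_{g-1}\}$ is a set of $g$ $ng\times ng$ PDAs that are Blackburn-compatible w.r.t. $P'_\ast$. Moreover, if $L_{\mathcal{P},P_\ast}(I_g)$ is a $g_b$-regular $ng\times ng$ PDA, then $L_{\mathcal{P}',P'_\ast}(I_g)$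 is a $gg_b$-regular $ng^2\times ng^2$ PDA.
   Context: Notation: $[n]=\{0,1,\dots,n-1\}$. For positive integers $K,f$, a nonnegative integer $Z$ and a finite set $\mathcal{S}$ of integers, a $(K,f,Z,\mathcal{S})$ placement delivery array (PDA) is an $f\times K$ array $P=[p_{j,k}]$ with entries in $\mathcal{S}\cup\{\ast\}$ such that: (C1) $\ast$ appears exactly $Z$ times in each column; (C2) each $s\in\mathcal{S}$ occurs at least once; (C3, Blackburn property) if two distinct cells $(j_1,k_1)$, $(j_2,k_2)$ contain the same integer then $p_{j_1,k_2}=p_{j_2,k_1}=\ast$. It is $g$-regular if each integer of $\mathcal{S}$ occurs exactly $g$ times. Blackburn compatibility: for PDAs $P_0=[p^{(0)}_{ij}]$, $P_1=[p^{(1)}_{ij}]$, $P_\ast=[p^{(\ast)}_{ij}]$ of the same size, $P_0$ and $P_1$ are Blackburn-compatible w.r.t. $P_\ast$ if, whenever $p^{(0)}_{i_1j_1}=p^{(1)}_{i_2j_2}\neq\ast$, we have $p^{(\ast)}_{i_1j_2}=p^{(\ast)}_{i_2j_1}=\ast$. A family $P_0,\dots,P_{g-1}$ is Blackburn-compatible w.r.t. $P_\ast$ if $P_i,P_j$ are for all $i\ne j$. Lifting of $I_g$: for $\mathcal{P}=\{P_0,\dots,P_{g-1}\}$ and $P_\ast$ of the same size, $L_{\mathcal{P},P_\ast}(I_g)$ is the $g\times g$ block array whose $i$-th diagonal block is $P_i$ and whose off-diagonal blocks are copies of $P_\ast$ with integers relabelled so that the integer sets of these copies are disjoint from each other and from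 the integers of $P_0,\dots,P_{g-1}$.
   Formalization: The PDAs P_0,…,P_{g-1} are additionally assumed to have the same number Z of stars per column; otherwise the arrays P'_i need not be PDAs (e.g. g=2, n=1, P_0=[*], P_1=[0], P_*=[*]). *)

(* Defs.v *)
From mathcomp Require Import all_boot all_order all_algebra.
From mathcomp Require Import finmap mxtens.

Set Implicit Arguments.
Unset Strict Implicit.
Unset Printing Implicit Defensive.

Local Open Scope fset_scope.
Local Open Scope nat_scope.

(* An f x K array with entries in S \cup {*}, S a set of integers; the symbol *)
(* "*" is encoded as None.                                                    *)
Notation array f K := 'M[option int]_(f, K).

Definition ints (f K : nat) (A : array f K) : {fset int} :=
  [fset s in pmap (fun c : 'I_f * 'I_K => A c.1 c.2) (enum {: 'I_f * 'I_K})].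

(* P has f rows and K columns. *)
Record pda (K f Z : nat) (S : {fset int}) (P : array f K) : Prop := Pda {
  pda_cols_gt0 : 0 < K;
  pda_rows_gt0 : 0 < f;
  pda_entries : forall j k s, P j k = Some s -> s \in S;
  pda_stars : forall k : 'I_K, #|[set j : 'I_f | P j k == None]| = Z;
  pda_occurs : forall s, s \in S -> exists j k, P j k = Some s;
  pda_Blackburn : forall j1 k1 j2 k2 s, (j1, k1) != (j2, k2) ->
    P j1 k1 = Some s -> P j2 k2 = Some s ->
    P j1 k2 = None /\ P j2 k1 = None }.

Definition is_pda (f K : nat) (P : array f K) : Prop :=
  exists Z S, pda Z S P.

Definition regular_pda (f K : nat) (r : nat) (P : array f K) : Prop :=
  exists Z S, pda Z S P /\
    forall s, s \in S ->
      #|[set c : 'I_f * 'I_K | P c.1 c.2 == Some s]| = r.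

Definition Blackburn_compatible (f K : nat) (P0 P1 Pstar : array f K) : Prop :=
  forall i1 j1 i2 j2 s, P0 i1 j1 = Some s -> P1 i2 j2 = Some s ->
    Pstar i1 j2 = None /\ Pstar i2 j1 = None.

(* The members of the family share the number Z of stars per column, but may  *)
(* have different integer sets; Pstar may have another number of stars. A     *)
(* common Z is needed for an array whose block columns contain different      *)
(* members of the family to satisfy the column condition of a PDA.            *)
Definition compatible_pdas (g f K : nat) (P : 'I_g -> array f K)
    (Pstar : array f K) : Prop :=
  [/\ exists Z, forall i, exists S, pda Z S (P i),
      is_pda Pstar
    & forall i j, i != j -> Blackburn_compatible (P i) (P j) Pstar].

Definition relabel (f K : nat) (rho : int -> int) (P : array f K) :
  array f K := map_mx (omap rho) P.

Lemma block_dim (g n : nat) : \sum_(a < g) n = g * n.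
Proof. by rewrite sum_nat_const card_ord. Qed.

(* \mxblock produces an array of size \sum_(a < g) n; the cast only rewrites  *)
(* this size as g * n.                                                        *)
Definition block_array (g n : nat) (B : 'I_g -> 'I_g -> array n n) :
    array (g * n) (g * n) :=
  castmx (block_dim g n, block_dim g n) (\mxblock_(a < g, b < g) B a b)%R.

(* L is one of the possible liftings of I_g: the relabelling of each          *)
(* off-diagonal copy of Pstar is arbitrary, subject to the disjointness of    *)
(* the integer sets.                                                          *)
Definition lifting_I (g n : nat) (P : 'I_g -> array n n) (Pstar : array n n)
    (L : array (g * n) (g * n)) : Prop :=
  exists rho : 'I_g -> 'I_g -> int -> int,
  let Q a b := relabel (rho a b) Pstar in
  [/\ forall a b, a != b -> {in ints Pstar &, injective (rho a b)},
      forall a b a' b', a != b -> a' != b' -> (a, b) != (a', b') ->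
        [disjoint ints (Q a b) & ints (Q a' b')],
      forall a b i, a != b -> [disjoint ints (Q a b) & ints (P i)]
    & L = block_array (fun a b => if a == b then P a else Q a b)].

(* The array P'_i. With 'I_g = {0, ..., g-1}, ordS is the cyclic shift        *)
(* l |-> (l + 1) mod g, and the diagonal block in (0-based) position a is     *)
(* P_{pi^i(a + 1)}, with a + 1 read modulo g. For b != a, unlift a b = Some c *)
(* where c : 'I_g.-1 is the rank of b among the columns different from a, and *)
(* mxtens_index (a, c) = a * (g - 1) + c is the rank of the block (a, b) in   *)
(* the row by row reading of the off-diagonal blocks.                         *)
Definition shifted_array (g n : nat) (P : 'I_g -> array n n)
    (Q : 'I_(g * g.-1) -> array n n) (i : 'I_g) : array (g * n) (g * n) :=
  block_array (fun a b =>
    if unlift a b is Some c then Q (mxtens_index (a, c))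
    else P (iter i (@ordS g) (ordS a))).

Definition block_diag_array (g n : nat) (Q : array n n) :
    array (g * n) (g * n) :=
  block_array (fun a b : 'I_g => if a == b then Q else const_mx None).

(* Main.v *)
(** An integer shared by two blocks of a lifting of I_g lies either in two
    diagonal blocks or twice in the same off-diagonal block; compatibility with
    P_* settles the first case and the Blackburn property of P_* the second, so
    a lifting of a compatible family is a PDA. It is r-regular exactly when the
    integers of P_* occur r times in P_* (if g > 1) and those of the P_i occur
    r times in P_0, ..., P_(g-1) together. Each P'_i is itself a lifting, of
    the family P permuted by a power of the cyclic shift, so P'_i is
    g_b-regular, and all the P'_i contain the same blocks. Hence an integer of
    the family P' occurs g g_b times in it, and so does an integer of P'_*,
    which consists of g copies of P_*. *)

Require Import Defs.
From mathcomp Require Import all_boot all_order all_algebra.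
From mathcomp Require Import finmap mxtens.

Set Implicit Arguments.
Unset Strict Implicit.
Unset Printing Implicit Defensive.

Local Open Scope fset_scope.
Local Open Scope nat_scope.

(** * Integer sets and multiplicities *)

Definition occ (f K : nat) (s : int) (A : array f K) : nat :=
  #|[set c : 'I_f * 'I_K | A c.1 c.2 == Some s]|.

Lemma intsP (f K : nat) (A : array f K) s :
  reflect (exists j k, A j k = Some s) (s \in ints A).
Proof.
rewrite /ints inE mem_pmap; apply: (iffP mapP).
  by case=> -[j k] _ /= ->; exists j, k.
by case=> j [k Ajk]; exists (j, k); rewrite ?mem_enum.
Qed.

Lemma mem_ints (f K : nat) (A : array f K) s j k :
  A j k = Some s -> s \in ints A.
Proof. by move=> Ajk; apply/intsP; exists j, k. Qed.

(** Thus the set quantified existentially in [is_pda] and [regular_pda] can always be taken to be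
    [ints A]. *)
Lemma pda_ints (f K Z : nat) S (A : array f K) : pda Z S A -> S = ints A.
Proof.
move=> PA; apply/fsetP => s; apply/idP/intsP; first exact: (pda_occurs PA).
by case=> j [k]; apply: (pda_entries PA).
Qed.

Lemma occ_eq0 (f K : nat) s (A : array f K) : s \notin ints A -> occ s A = 0.
Proof.
move=> sA; apply/eqP; rewrite cards_eq0; apply/eqP/setP => -[j k].
by rewrite !inE; apply: contraNF sA => /eqP/mem_ints.
Qed.

Lemma fdisjoint_neq (A B : {fset int}) s t :
  [disjoint A & B] -> s \in A -> t \in B -> s <> t.
Proof. by move=> /fdisjointP AB /AB sB tB st; rewrite st tB in sB. Qed.

(** * Injective relabelling *)

Section Relabel.
Context (f K : nat) (A : array f K) (r : int -> int).

Lemma relabel_None j k : (relabel r A j k == None) = (A j k == None).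
Proof. by rewrite mxE; case: (A j k). Qed.

Lemma relabel_Some j k s :
  relabel r A j k = Some s -> exists2 t, A j k = Some t & s = r t.
Proof. by rewrite mxE; case: (A j k) => //= t [<-]; exists t. Qed.

Lemma ints_relabel s : s \in ints (relabel r A) -> exists2 t, t \in ints A & s = r t.
Proof.
by case/intsP=> j [k] /relabel_Some[t /mem_ints ? ->]; exists t.
Qed.

Lemma mem_ints_relabel s : s \in ints A -> r s \in ints (relabel r A).
Proof.
by case/intsP=> j [k Ajk]; apply/intsP; exists j, k; rewrite mxE Ajk.
Qed.

Hypothesis r_inj : {in ints A &, injective r}.

Lemma occ_relabel s : s \in ints A -> occ (r s) (relabel r A) = occ s A.
Proof.
move=> sA; apply: eq_card => -[j k]; rewrite !inE mxE /=.
case Ajk: (A j k) => [t|] //=; apply/eqP/eqP => [[]|[->]] //.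
by move/r_inj=> -> //; apply: mem_ints Ajk.
Qed.

(** Stars stay in place, and injectivity pulls equal labels back to equal integers of [A]. *)
Lemma is_pda_relabel : is_pda A -> is_pda (relabel r A).
Proof.
case=> Z [S PA]; exists Z, (ints (relabel r A)).
split=> [|||k|s|j1 k1 j2 k2 s neq].
- exact: pda_cols_gt0 PA.
- exact: pda_rows_gt0 PA.
- by move=> j k s /mem_ints.
- by rewrite -(pda_stars PA k); apply: eq_card => j; rewrite !inE relabel_None.
- by move/intsP.
move=> /relabel_Some[t1 A1 ->] /relabel_Some[t2 A2] t12.
have t12' : t1 = t2 by apply: r_inj; rewrite ?(mem_ints A1) ?(mem_ints A2).
rewrite -t12' in A2; have [A12 A21] := pda_Blackburn PA neq A1 A2.
by rewrite !mxE A12 A21.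
Qed.

End Relabel.

(** * Block arrays in block coordinates *)

Section BlockArray.
Context {g n : nat}.
Implicit Types B : 'I_g -> 'I_g -> array n n.

(** Coordinates (block, position inside the block); being a bijection, it hides the cast and the
    dependent sum behind [block_array]. *)
Definition block_index (c : 'I_g * 'I_n) : 'I_(g * n) :=
  cast_ord (block_dim g n) (@tagnat.Rank g (fun=> n) c.1 c.2).

Lemma block_index_bij : bijective block_index.
Proof.
pose h p : 'I_g * 'I_n :=
  let u := @tagnat.sig g (fun=> n) (cast_ord (esym (block_dim g n)) p) in
  (tag u, tagged u).
exists h => [[a i]|p]; rewrite /h /block_index /=.
  by rewrite cast_ordK /tagnat.Rank tagnat.rankK.
by rewrite -tagnat.rankE tagnat.sigK cast_ordKV.
Qed.

Lemma block_indexP p : exists a i, p = block_index (a, i).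
Proof.
case: block_index_bij => h _ hK.
by exists (h p).1, (h p).2; rewrite -surjective_pairing hK.
Qed.

Lemma sum_block_index (F : 'I_(g * n) -> nat) :
  \sum_p F p = \sum_a \sum_i F (block_index (a, i)).
Proof.
rewrite (reindex block_index) ?pair_big /=; first by apply: eq_bigr => -[].
exact/onW_bij/block_index_bij.
Qed.

Lemma block_arrayE B a i b j :
  block_array B (block_index (a, i)) (block_index (b, j)) = B a b i j.
Proof.
rewrite castmxE !cast_ordK /=.
have /matrixP/(_ i j) := @mxblockK _ g g (fun=> n) (fun=> n) B a b.
by rewrite mxE.
Qed.

Lemma eq_block_array B B' :
  (forall a b, B a b = B' a b) -> block_array B = block_array B'.
Proof.
move=> eqB; apply/matrixP => p q.
have [a [i ->]] := block_indexP p; have [b [j ->]] := block_indexP q.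
by rewrite !block_arrayE eqB.
Qed.

Lemma stars_block B (b : 'I_g) (j : 'I_n) :
  #|[set p | block_array B p (block_index (b, j)) == None]| =
  \sum_a #|[set i | B a b i j == None]|.
Proof.
rewrite -sum1dep_card big_mkcond sum_block_index; apply: eq_bigr => a _.
rewrite -sum1dep_card [RHS]big_mkcond; apply: eq_bigr => i _.
by rewrite block_arrayE.
Qed.

Lemma ints_block B s :
  reflect (exists a b, s \in ints (B a b)) (s \in ints (block_array B)).
Proof.
apply: (iffP (intsP _ _)) => [[p [q]]|[a [b /intsP[i [j Bij]]]]].
  have [a [i ->]] := block_indexP p; have [b [j ->]] := block_indexP q.
  by rewrite block_arrayE => /mem_ints; exists a, b.
by exists (block_index (a, i)), (block_index (b, j)); rewrite block_arrayE.
Qed.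

End BlockArray.

Lemma occE (f K : nat) s (A : array f K) :
  occ s A = \sum_j \sum_k (A j k == Some s).
Proof.
by rewrite /occ -sum1dep_card big_mkcond pair_big; apply: eq_bigr => c _.
Qed.

Lemma occ_block (g n : nat) s (B : 'I_g -> 'I_g -> array n n) :
  occ s (block_array B) = \sum_a \sum_b occ s (B a b).
Proof.
rewrite occE sum_block_index; apply: eq_bigr => a _.
under eq_bigr do rewrite sum_block_index.
rewrite exchange_big; apply: eq_bigr => b _.
by rewrite occE; apply: eq_bigr => i _; apply: eq_bigr => j _; rewrite block_arrayE.
Qed.

(** A column meets one copy of [Q] and g - 1 all-star blocks of height n. If equal integers lie in
    different diagonal blocks, the crossing cells fall into all-star blocks. *)
Lemma is_pda_block_diag (g n : nat) (Q : array n n) :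
  0 < g -> is_pda Q -> is_pda (block_diag_array g Q).
Proof.
move=> g_gt0 [Z [S PQ]]; rewrite /block_diag_array; set L := block_array _.
have n_gt0 := pda_rows_gt0 PQ.
exists (Z + g.-1 * n), (ints L); split=> [|||q|s|p1 q1 p2 q2 s].
- by rewrite muln_gt0 g_gt0.
- by rewrite muln_gt0 g_gt0.
- by move=> j k s /mem_ints.
- have [b [j ->]] := block_indexP q.
  rewrite stars_block (bigD1 b) //= eqxx (pda_stars PQ); congr (_ + _).
  rewrite -[in RHS](card_ord g) -(cardC1 b) -sum_nat_const.
  apply: eq_bigr => a /negPf ->; rewrite -[RHS](card_ord n) -cardsT.
  by apply: eq_card => i; rewrite !inE mxE.
- by move/intsP.
have [a1 [i1 ->]] := block_indexP p1; have [b1 [j1 ->]] := block_indexP q1.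
have [a2 [i2 ->]] := block_indexP p2; have [b2 [j2 ->]] := block_indexP q2.
rewrite !block_arrayE; case: (eqVneq a1 b1) => [<-|_]; last by rewrite mxE.
case: (eqVneq a2 b2) => [<-|_]; last by rewrite mxE.
case: (eqVneq a1 a2) => [<-|_] neq Q1 Q2; last by rewrite !mxE.
apply: (pda_Blackburn PQ _ Q1 Q2).
by apply: contraNneq neq => -[-> ->].
Qed.

(** * Liftings of I_g: counts and the PDA property *)

Section Lifting.
Context (g n : nat) (P : 'I_g -> array n n) (Pstar : array n n).
Context (rho : 'I_g -> 'I_g -> int -> int).
Let Q a b := relabel (rho a b) Pstar.
Let B a b := if a == b then P a else Q a b.
Hypothesis rho_inj : forall a b, a != b -> {in ints Pstar &, injective (rho a b)}.
Hypothesis disjQ : forall a b a' b', a != b -> a' != b' ->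
  (a, b) != (a', b') -> [disjoint ints (Q a b) & ints (Q a' b')].
Hypothesis disjP :
  forall a b i, a != b -> [disjoint ints (Q a b) & ints (P i)].

(** All other pairs of blocks have disjoint integer sets. Both the counts and the Blackburn property
    below rest on this dichotomy. *)
Lemma lifting_shared_int a b a' b' s :
  s \in ints (B a b) -> s \in ints (B a' b') ->
  a = b /\ a' = b' \/ a != b /\ (a, b) = (a', b').
Proof.
rewrite /B; case: (eqVneq a b) => ab; case: (eqVneq a' b') => ab' s1 s2.
- by left.
- by case: (fdisjoint_neq (disjP a ab') s2 s1).
- by case: (fdisjoint_neq (disjP a' ab) s1 s2).
case: (eqVneq (a, b) (a', b')) => [?|neq]; first by right.
by case: (fdisjoint_neq (disjQ ab ab' neq) s1 s2).
Qed.

Lemma occ_lifting_diag i s :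
  s \in ints (P i) -> occ s (block_array B) = \sum_k occ s (P k).
Proof.
move=> sP; rewrite occ_block; apply: eq_bigr => a _.
rewrite (bigD1 a) //= big1 ?addn0 => [|b ba]; first by rewrite /B eqxx.
apply: occ_eq0; apply/negP => sB.
have sBi : s \in ints (B i i) by rewrite /B eqxx.
case: (lifting_shared_int sB sBi) => [[ab _]|[ab [ai bi]]].
  by rewrite ab eqxx in ba.
by rewrite ai bi eqxx in ba.
Qed.

(** The integers of a relabelled copy are confined to its own block, and injectivity preserves their
    multiplicities. *)
Lemma occ_lifting_off a b s : a != b -> s \in ints Pstar ->
  occ (rho a b s) (block_array B) = occ s Pstar.
Proof.
move=> ab sP; rewrite -(occ_relabel (rho_inj ab) sP) occ_block.
have sQ := mem_ints_relabel (rho a b) sP.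
have sB : rho a b s \in ints (B a b) by rewrite /B (negPf ab).
rewrite pair_big (bigD1 (a, b)) //= big1 ?addn0 => [|[a' b'] neq].
  by rewrite /B (negPf ab).
apply: occ_eq0; apply/negP => sB' /=.
case: (lifting_shared_int sB sB') => [[E _]|[_ E]].
  by rewrite E eqxx in ab.
by rewrite E eqxx in neq.
Qed.

Lemma lifting_blocks_pda Z Zs Ss : 0 < g ->
  (forall i, exists S, pda Z S (P i)) -> pda Zs Ss Pstar ->
  (forall i j, i != j -> Blackburn_compatible (P i) (P j) Pstar) ->
  pda (Z + g.-1 * Zs) (ints (block_array B)) (block_array B).
Proof.
move=> g_gt0 pdaP pdaPs compat; have n_gt0 := pda_rows_gt0 pdaPs.
split=> [|||q|s|p1 q1 p2 q2 s].
- by rewrite muln_gt0 g_gt0.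
- by rewrite muln_gt0 g_gt0.
- by move=> j k s /mem_ints.
(* Block column b has Z stars from [P b] and Zs from each of the g - 1 copies of [Pstar]. *)
- have [b [j ->]] := block_indexP q; have [S PB] := pdaP b.
  rewrite stars_block (bigD1 b) //= /B eqxx (pda_stars PB); congr (_ + _).
  rewrite -[in RHS](card_ord g) -(cardC1 b) -sum_nat_const.
  apply: eq_bigr => a /negPf ->; rewrite -(pda_stars pdaPs j).
  by apply: eq_card => i; rewrite !inE relabel_None.
- by move/intsP.
have [a1 [i1 ->]] := block_indexP p1; have [b1 [j1 ->]] := block_indexP q1.
have [a2 [i2 ->]] := block_indexP p2; have [b2 [j2 ->]] := block_indexP q2.
rewrite !block_arrayE => neq B1 B2.
case: (lifting_shared_int (mem_ints B1) (mem_ints B2)).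
  case=> E1 E2; subst b1 b2; move: B1 B2 neq; rewrite /B !eqxx eq_sym.
  case: (eqVneq a2 a1) => [->|neq12] B1 B2 neq.
    have [S PB] := pdaP a1; apply: (pda_Blackburn PB _ B1 B2).
    by apply: contraNneq neq => -[-> ->].
  (* The crossing cells lie in off-diagonal copies of [Pstar], where compatibility puts stars. *)
  rewrite eq_sym in neq12; have [E1 E2] := compat _ _ neq12 _ _ _ _ _ B1 B2.
  by rewrite !mxE E1 E2.
case=> ab [E1 E2]; subst a2 b2; move: B1 B2; rewrite /B (negPf ab) => B1 B2.
have [Zq [Sq PQ]] : is_pda (Q a1 b1).
  by apply: is_pda_relabel (rho_inj ab) _; exists Zs, Ss.
apply: (pda_Blackburn PQ _ B1 B2).
by apply: contraNneq neq => -[-> ->].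
Qed.

End Lifting.

Lemma lifting_is_pda (g n Z Zs : nat) S (P : 'I_g -> array n n) Pstar L :
  0 < g -> (forall i, exists S, pda Z S (P i)) -> pda Zs S Pstar ->
  (forall i j, i != j -> Blackburn_compatible (P i) (P j) Pstar) ->
  lifting_I P Pstar L -> pda (Z + g.-1 * Zs) (ints L) L.
Proof.
move=> g_gt0 pdaP pdaPs compat [rho [rho_inj disjQ disjP ->]].
exact: (lifting_blocks_pda rho_inj disjQ disjP g_gt0 pdaP pdaPs compat).
Qed.

(** * Regularity of liftings *)

Lemma regular_pdaE (f K r : nat) (A : array f K) :
  regular_pda r A <-> is_pda A /\ forall s, s \in ints A -> occ s A = r.
Proof.
split=> [[Z [S [PA reg]]]|[[Z [S PA]] reg]]; last first.
  by exists Z, S; split=> // s; rewrite (pda_ints PA); apply: reg.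
by split=> [|s]; [exists Z, S | rewrite -(pda_ints PA); apply: reg].
Qed.

(** The premise [a != b] expresses g > 1: for g = 1 no copy of [Pstar] occurs. Since the criterion
    is free of the relabellings, it carries regularity from one lifting to another. *)
Lemma lifting_regular (g n r : nat) (P : 'I_g -> array n n) Pstar L :
  lifting_I P Pstar L -> is_pda L ->
  regular_pda r L <->
    (forall a b : 'I_g, a != b ->
       forall s, s \in ints Pstar -> occ s Pstar = r) /\
    (forall i s, s \in ints (P i) -> \sum_k occ s (P k) = r).
Proof.
case=> rho [rho_inj disjQ disjP LE] pdaL; rewrite regular_pdaE.
split=> [[_ reg]|[regs regP]]; split=> //.
- move=> a b ab s sP; rewrite -(occ_lifting_off rho_inj disjQ disjP ab sP) -LE.
  apply: reg; rewrite LE; apply/ints_block; exists a, b.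
  by rewrite (negPf ab); apply: mem_ints_relabel.
- move=> i s sP; rewrite -(occ_lifting_diag disjQ disjP sP) -LE.
  by apply: reg; rewrite LE; apply/ints_block; exists i, i; rewrite eqxx.
move=> s; rewrite LE => /ints_block[a [b]]; case: (eqVneq a b) => [_|ab].
  by move=> sP; rewrite (occ_lifting_diag disjQ disjP sP); apply: regP sP.
case/ints_relabel=> t tP ->.
by rewrite (occ_lifting_off rho_inj disjQ disjP ab tP); apply: regs ab _ tP.
Qed.

Lemma occ_block_diag (g n : nat) s (Q : array n n) :
  occ s (block_diag_array g Q) = g * occ s Q.
Proof.
rewrite occ_block -[in RHS](card_ord g) -sum_nat_const; apply: eq_bigr => a _.
rewrite (bigD1 a) //= eqxx big1 ?addn0 // => b; rewrite eq_sym => /negPf ->.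
by apply: occ_eq0; apply/negP => /intsP[i [j]]; rewrite mxE.
Qed.

Lemma ints_block_diag (g n : nat) s (Q : array n n) :
  s \in ints (block_diag_array g Q) -> s \in ints Q.
Proof.
case/ints_block=> a [b]; case: ifP => // _.
by case/intsP=> i [j]; rewrite mxE.
Qed.

(** * Cyclic shifts and the arrays P'_i *)

Lemma iter_ordS_inj g i : injective (iter i (@ordS g)).
Proof. by elim: i => //= i IHi x y /ordS_inj/IHi. Qed.

(** The values are x + i and x + j modulo g, with i, j < g. Hence P'_i and P'_j carry different
    members of the family at each diagonal position. *)
Lemma iter_ordS_neq g (i j x : 'I_g) :
  i != j -> iter i (@ordS g) x != iter j (@ordS g) x.
Proof.
have val_iter k : iter k (@ordS g) x = (x + k) %% g :> nat.
  elim: k => [|k IHk]; first by rewrite addn0 modn_small.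
  by rewrite /= IHk -addn1 modnDml addn1 addnS.
apply: contraNneq => /(congr1 (@nat_of_ord g)); rewrite !val_iter => /eqP.
by rewrite eqn_modDl !modn_small.
Qed.

Section Shifted.
Context (g n : nat) (P : 'I_g -> array n n).

Lemma occ_shifted (Q : 'I_(g * g.-1) -> array n n) s i j :
  occ s (shifted_array P Q i) = occ s (shifted_array P Q j).
Proof.
(* The right-hand side is independent of k: the shift only permutes the diagonal. The branch [P a]
   is a dummy, never reached when [b != a]. *)
have occE k : occ s (shifted_array P Q k) = \sum_a occ s (P a) +
    \sum_a \sum_(b | b != a)
      occ s (if unlift a b is Some c then Q (mxtens_index (a, c)) else P a).
  rewrite occ_block [in RHS]
    (reindex_inj (inj_comp (@iter_ordS_inj g k) (@ordS_inj g))).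
  rewrite -big_split /=.
  apply: eq_bigr => a _; rewrite (bigD1 a) //= unlift_none; congr (_ + _).
  by apply: eq_bigr => b; rewrite eq_sym => /unlift_some[c _ ->].
by rewrite !occE.
Qed.

Context (Pstar : array n n) (rho : option 'I_(g * g.-1) -> int -> int).
Context (T : option 'I_(g * g.-1) -> {fset int}).
Hypothesis T_disjoint : forall j k, j != k -> [disjoint T j & T k].
Hypothesis T_disjoint_P : forall j i, [disjoint T j & ints (P i)].
Hypothesis rho_inj : forall j, {in ints Pstar &, injective (rho j)}.
Hypothesis rho_im : forall j, [fset rho j s | s in ints Pstar] = T j.
Let P' := shifted_array P (fun j => relabel (rho (Some j)) Pstar).

Lemma ints_relabel_T j s : s \in ints (relabel (rho j) Pstar) -> s \in T j.
Proof. by case/ints_relabel=> t tP ->; rewrite -rho_im in_imfset. Qed.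

Lemma shifted_lifting (i : 'I_g) :
  lifting_I (fun a => P (iter i (@ordS g) (ordS a))) Pstar (P' i).
Proof.
(* The label of an off-diagonal block is its rank; on the diagonal it is [None], where [lifting_I]
   asks nothing of the relabelling. *)
pose lab a b := omap (fun c => mxtens_index (a, c)) (@unlift g a b).
have labE (a b : 'I_g) : a != b ->
    exists2 c, b = lift a c & lab a b = Some (mxtens_index (a, c)).
  by rewrite /lab => /unlift_some[c -> ->]; exists c.
exists (fun a b => rho (lab a b)); split=> [a b _|a b a' b' ab ab' neq|a b k _|].
- exact: rho_inj.
- have neq_lab : lab a b != lab a' b'.
    have [c bE ->] := labE _ _ ab; have [c' bE' ->] := labE _ _ ab'.
    apply: contraNneq neq => /Some_inj/(can_inj (@mxtens_indexK _ _))[aa cc].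
    by rewrite bE bE' aa cc.
  apply/fdisjointP => s /ints_relabel_T sT; apply/negP => /ints_relabel_T sT'.
  exact: fdisjoint_neq (T_disjoint neq_lab) sT sT' _.
- apply/fdisjointP => s /ints_relabel_T sT; apply/negP => sP.
  exact: fdisjoint_neq (T_disjoint_P _ _) sT sP _.
apply: eq_block_array => a b; case: (eqVneq a b) => [<-|ab].
  by rewrite unlift_none.
by rewrite /lab; have [c _ ->] := unlift_some ab.
Qed.

(** An integer shared by off-diagonal blocks fixes the block position, so the crossing cells lie in
    an all-star block of P'_*; so they do for two different diagonal positions. At the same diagonal
    position the two members differ and their compatibility applies. A diagonal and an off-diagonal
    block share no integer. *)
Lemma shifted_compatible (i j : 'I_g) : i != j ->
  (forall i j, i != j -> Blackburn_compatible (P i) (P j) Pstar) ->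
  Blackburn_compatible (P' i) (P' j)
    (block_diag_array g (relabel (rho None) Pstar)).
Proof.
move=> ij compat p1 q1 p2 q2 s.
have [a1 [i1 ->]] := block_indexP p1; have [b1 [j1 ->]] := block_indexP q1.
have [a2 [i2 ->]] := block_indexP p2; have [b2 [j2 ->]] := block_indexP q2.
rewrite !block_arrayE.
case: (unliftP a1 b1) => [c1|] E1; case: (unliftP a2 b2) => [c2|] E2 B1 B2.
- have sT1 := ints_relabel_T (mem_ints B1).
  have sT2 := ints_relabel_T (mem_ints B2).
  case: (eqVneq (mxtens_index (a1, c1)) (mxtens_index (a2, c2))) => [|neq].
    move/(can_inj (@mxtens_indexK _ _)) => -[aa cc].
    by rewrite E1 E2 aa cc (negPf (neq_lift a2 c2)) !mxE.
  have neqS : Some (mxtens_index (a1, c1)) != Some (mxtens_index (a2, c2)) by [].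
  by case: (fdisjoint_neq (T_disjoint neqS) sT1 sT2).
- have sT1 := ints_relabel_T (mem_ints B1).
  by case: (fdisjoint_neq (T_disjoint_P _ _) sT1 (mem_ints B2)).
- have sT2 := ints_relabel_T (mem_ints B2).
  by case: (fdisjoint_neq (T_disjoint_P _ _) sT2 (mem_ints B1)).
rewrite E1 E2 [a2 == a1]eq_sym; case: (eqVneq a1 a2) => [aa|_]; last by rewrite !mxE.
rewrite aa in B1.
have [S12 S21] := compat _ _ (iter_ordS_neq (ordS a2) ij) _ _ _ _ _ B1 B2.
by rewrite !mxE S12 S21.
Qed.

End Shifted.

Theorem lemma23 (g n : nat) (g_gt0 : 0 < g)
    (P : 'I_g -> array n n) (Pstar : array n n) (S : {fset int})
    (P_compatible : compatible_pdas P Pstar)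
    (ints_Pstar : ints Pstar = S)
    (* Some j stands for j in [g(g-1)] and None for the additional index t *)
    (T : option 'I_(g * g.-1) -> {fset int})
    (T_disjoint : forall j k, j != k -> [disjoint T j & T k])
    (T_disjoint_P : forall j i, [disjoint T j & ints (P i)])
    (card_T : forall j, #|` T j| = #|` S|)
    (rho : option 'I_(g * g.-1) -> int -> int)
    (rho_inj : forall j, {in S &, injective (rho j)})
    (rho_im : forall j, [fset rho j s | s in S] = T j) :
  let P' := shifted_array P (fun j => relabel (rho (Some j)) Pstar) in
  let Pstar' := block_diag_array g (relabel (rho None) Pstar) in
  compatible_pdas P' Pstar' /\
  (forall (gb : nat) (L : array (g * n) (g * n))
          (L' : array (g * (g * n)) (g * (g * n))),
     lifting_I P Pstar L -> regular_pda gb L ->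
     lifting_I P' Pstar' L' -> regular_pda (g * gb) L').
Proof.
move=> P' Pstar'; subst S.
have [[Z pdaP] [Zs [Ss pdaPs]] compat] := P_compatible.
have P'_lifting := shifted_lifting T_disjoint T_disjoint_P rho_inj rho_im.
have pdaP' i : pda (Z + g.-1 * Zs) (ints (P' i)) (P' i).
  apply: lifting_is_pda g_gt0 _ pdaPs _ (P'_lifting i) => [a|a b ab].
    exact: pdaP.
  (* Shifting is injective, so distinct positions still hold distinct members. *)
  by apply: compat; rewrite (inj_eq (@iter_ordS_inj g i)) (inj_eq (@ordS_inj g)).
have P'_compatible : compatible_pdas P' Pstar'.
  split=> [||i j ij]; first by exists (Z + g.-1 * Zs) => i; exists (ints (P' i)).
    by apply: is_pda_block_diag (is_pda_relabel (rho_inj _) _) => //; exists Zs, Ss.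
  exact: shifted_compatible T_disjoint T_disjoint_P rho_im _ _ ij compat.
split=> // gb L L' L_lifting L_regular L'_lifting.
have pdaL : is_pda L by have /regular_pdaE[] := L_regular.
have [regs regP] := (lifting_regular gb L_lifting pdaL).1 L_regular.
have pdaL' : is_pda L'.
  have [[Z' ?] [Zs' [Ss' pdaPs']] ?] := P'_compatible.
  exists (Z' + g.-1 * Zs'), (ints L').
  exact: lifting_is_pda g_gt0 _ pdaPs' _ L'_lifting.
apply/(lifting_regular _ L'_lifting pdaL'); split=> [a b ab s|i s sP'].
  (* The same pair [a != b] witnesses g > 1 for [L], so t occurs gb times in [Pstar], hence its
     label gb times in each of the g diagonal blocks. *)
  move/ints_block_diag/ints_relabel=> [t tP ->].
  by rewrite occ_block_diag (occ_relabel (rho_inj _) tP) (regs _ _ ab).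
have P'_regular : regular_pda gb (P' i).
  apply/(lifting_regular _ (P'_lifting i)); first by exists (Z + g.-1 * Zs), (ints (P' i)).
  (* The permuted family has the same total counts as [P]. *)
  split=> // a t tP; rewrite -(regP _ t tP).
  by rewrite [RHS](reindex_inj (inj_comp (@iter_ordS_inj g i) (@ordS_inj g))).
have [_ /(_ s sP') occP'] := (regular_pdaE _ _).1 P'_regular.
(* Each of the g arrays contains s as often as P'_i does, namely gb times. *)
under eq_bigr do rewrite (occ_shifted _ _ _ _ i) occP'.
by rewrite sum_nat_const card_ord.
Qed.
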